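(* Consider the family (indexed by $\eta\in\mathbb N$) of two-sided queueing systems with $n$ customer types and $n$ server types on a bipartite graph satisfying the perfect matching condition, operated under the fluid pricing policy $$\lambda_j(\mathbf q)=\eta\lambda_j^*\,\mathbf 1\{q_j^{(c)}<q_{\max}^\eta\},\qquad \mu_i(\mathbf q)=\eta\mu_i^*\,\mathbf 1\{q_i^{(s)}<q_{\max}^\eta\},$$ where $q_{\max}^\eta$ is a positive integer. Then, with any matching algorithm, in stationarity $$q_{\max}^\eta\left(\sum_{j=1}^n\lambda_j^*\,\mathbb P[q_j^{(c)}=q_{\max}^\eta]+\sum_{i=1}^n\mu_i^*\,\mathbb P[q_i^{(s)}=q_{\max}^\eta]\right)\ \ge\ \frac{\sum_{j}\lambda_j^*+\sum_i\mu_i^*}{2n+1/q_{\max}^\eta}.$$ Furthermore, if the complete resource pooling condition holds, then with max-weight matching and $q_{\max}^\eta\to\infty$ as $\eta\to\infty$, $$\lim_{\eta\to\infty}q_{\max}^\eta\left(\sum_{j=1}^n\lambda_j^*\,\mathbb P[q_j^{(c)}=q_{\max}^\eta]+\sum_{i=1}^n\mu_i^*\,\mathbb P[q_i^{(s)}=q_{\max}^\eta]\right)=\frac{\sum_j\lambda_j^*+\sum_i\mu_i^*}{2n}.$$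
   Context: **Model.** $N$ is a set of $n$ server types, $M$ a set of $n$ customer types, $E\subseteq N\times M$ the set of compatible pairs. The state $\mathbf q=(q^{(c)}_j;\ q^{(s)}_i)\in\mathbb Z_+^{2n}$ records the numbers of waiting customers and servers of each type. In state $\mathbf q$, type-$j$ customers arrive at Poisson rate $\lambda_j(\mathbf q)$ and type-$i$ servers at Poisson rate $\mu_i(\mathbf q)$. $\mathbb P$ is the stationary distribution. **Matching.** A (stationary) matching algorithm chooses, as a function of the state, which waiting compatible customer–server pairs to match (each matched pair leaves); i.e. it chooses $\mathbf y\in\mathbb Z_+^{n^2}$ with $\sum_iy_{ij}\le q_j^{(c)}$, $\sum_jy_{ij}\le q_i^{(s)}$, $y_{ij}=0$ for $(i,j)\notin E$, and at the next arrival the state becomes $\mathbf q+\mathbf e-\mathbf x$, where $\mathbf e$ is the unit vector of the arriving type and $x_j^{(c)}=\sum_iy_{ij}$, $x_i^{(s)}=\sum_jy_{ij}$. *Max-weight matching* is allowed to match the arrival itself: an arriving server of type $i$ is immediately matched with a waiting customer of a type $j$ maximizing $q_j^{(c)}$ over $\{j:(i,j)\in E\}$ if this maximum is positive; symmetrically for an arriving customer; ties arbitrary; if all compatible queues are empty, the arrival joins its own queue. **Fluid solution.** $(\boldsymbol\lambda^*,\boldsymbol\mu^*,\boldsymbol\chi^* )$ is an optimal solution of: maximize $\sum_j\lambda_jF_j(\lambda_j)-\sum_i\mu_iG_i(\mu_i)$ subject to $\lambda_j=\sum_i\chi_{ij}$, $\mu_i=\sum_j\chi_{ij}$, $\chi_{ij}\ge0$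 on $E$, $\chi_{ij}=0$ off $E$, where the $F_j$ are strictly decreasing, $G_i$ strictly increasing, $\lambda F_j(\lambda)$ is strictly concave and $\mu G_i(\mu)$ strictly convex; it is assumed $\boldsymbol\lambda^*,\boldsymbol\mu^*>0$. **Perfect matching condition.** $E$ has a perfect matching; without loss of generality server type $i$ is compatible with customer type $i$ for each $i\in\{1,\dots,n\}$. **Complete resource pooling condition.** For all nonempty $J\subsetneq M$ and nonempty $I\subsetneq N$, $\sum_{j\in J}\lambda_j^*<\sum_{i:\exists j\in J,(i,j)\in E}\mu_i^*$ and $\sum_{i\in I}\mu_i^*<\sum_{j:\exists i\in I,(i,j)\in E}\lambda_j^*$. *)

(* Defs.v *)
From HB Require Import structures.
From mathcomp Require Import all_boot all_order all_algebra all_fingroup.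
From mathcomp Require Import all_classical all_reals all_analysis.
Set Implicit Arguments.
Unset Strict Implicit.
Unset Printing Implicit Defensive.
Import Order.TTheory GRing.Theory Num.Theory.
Import numFieldNormedType.Exports.
Local Open Scope classical_set_scope.
Local Open Scope ring_scope.

(* A type is [inl j] for customer type j and [inr i] for server type i; it
   indexes the queues and labels the arrivals. *)
Definition agent (n : nat) := ('I_n + 'I_n)%type.

Definition state (n : nat) := {ffun agent n -> nat}.

HB.instance Definition _ n := Countable.on (state n).

Definition empty_state n : state n := [ffun=> 0%N].

(* Every set of states is an event. *)
HB.instance Definition _ n := isPointed.Build (state n) (empty_state n).
HB.instance Definition _ n := @isMeasurable.Build default_measure_display
  (state n) discrete_measurable discrete_measurable0
  discrete_measurableC discrete_measurableU.

(* The queues once an agent of type [a] has arrived, before any departure. *)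
Definition add_agent n (q : state n) (a : agent n) : state n :=
  [ffun b => (q b + (b == a))%N].

(* In a matrix of matches [y], the entry [y i j] is the number of servers of
   type i matched to customers of type j. *)
Definition feasible_match n (E : {set 'I_n * 'I_n}) (q : state n)
    (y : 'M[nat]_n) : Prop :=
  [/\ forall j, (\sum_i y i j <= q (inl j))%N,
      forall i, (\sum_j y i j <= q (inr i))%N &
      forall i j, (i, j) \notin E -> y i j = 0%N].

Definition remove_match n (q : state n) (y : 'M[nat]_n) : state n :=
  [ffun b => (q b - match b with
                    | inl j => \sum_i y i j
                    | inr i => \sum_j y i j
                    end)%N].

(* [y q a] is the matrix of matches executed when an agent of type [a] arrives
   in state [q]. *)
Definition matching (n : nat) := state n -> agent n -> 'M[nat]_n.

(* The arriving agent may take part in the matches. An algorithm that picks its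
   matches among the agents waiting in [q], before the arrival is known, is the
   case of a [y q a] that does not depend on [a] and is feasible in [q]; see
   [state_based_matching_algorithm]. *)
Definition matching_algorithm n (E : {set 'I_n * 'I_n}) (y : matching n) :
    Prop :=
  forall q a, feasible_match E (add_agent q a) (y q a).

Definition next_state n (y : matching n) (q : state n) (a : agent n) : state n :=
  remove_match (add_agent q a) (y q a).

Definition max_weight n (E : {set 'I_n * 'I_n}) (y : matching n) : Prop :=
  (forall (q : state n) i,
    (exists j, [/\ (i, j) \in E, (0 < q (inl j))%N,
       forall k, (i, k) \in E -> (q (inl k) <= q (inl j))%N &
       y q (inr i) = delta_mx i j]) \/
    ((forall j, (i, j) \in E -> q (inl j) = 0%N) /\
     y q (inr i) = const_mx 0%N)) /\
  (forall (q : state n) j,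
    (exists i, [/\ (i, j) \in E, (0 < q (inr i))%N,
       forall k, (k, j) \in E -> (q (inr k) <= q (inr i))%N &
       y q (inl j) = delta_mx i j]) \/
    ((forall i, (i, j) \in E -> q (inr i) = 0%N) /\
     y q (inl j) = const_mx 0%N)).

Lemma feasible_add_agent n (E : {set 'I_n * 'I_n}) (q : state n) a y :
  feasible_match E q y -> feasible_match E (add_agent q a) y.
Proof.
by case=> hc hs hE; split=> // k; rewrite ffunE (leq_trans _ (leq_addr _ _)).
Qed.

Lemma state_based_matching_algorithm n (E : {set 'I_n * 'I_n})
    (z : state n -> 'M[nat]_n) :
  (forall q, feasible_match E q (z q)) ->
  matching_algorithm E (fun q _ => z q).
Proof. by move=> hz q a; apply: feasible_add_agent. Qed.

Lemma feasible_match0 n (E : {set 'I_n * 'I_n}) (q : state n) :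
  feasible_match E q (const_mx 0%N).
Proof.
split=> [j|i|i j _]; last by rewrite mxE.
  by rewrite big1 // => i _; rewrite mxE.
by rewrite big1 // => j _; rewrite mxE.
Qed.

Lemma feasible_match1 n (E : {set 'I_n * 'I_n}) (q : state n) i j :
  (i, j) \in E -> (0 < q (inl j))%N -> (0 < q (inr i))%N ->
  feasible_match E q (delta_mx i j).
Proof.
move=> Eij qj qi; split=> [k|k|k l].
- have [->|kj] := eqVneq k j.
    rewrite (bigD1 i)//= big1 ?mxE ?eqxx ?addn0// => l /negPf li.
    by rewrite mxE li.
  by rewrite big1 // => l _; rewrite mxE (negPf kj) andbF.
- have [->|ki] := eqVneq k i.
    rewrite (bigD1 j)//= big1 ?mxE ?eqxx ?addn0// => l /negPf lj.
    by rewrite mxE lj andbF.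
  by rewrite big1 // => l _; rewrite mxE (negPf ki).
- rewrite mxE; have [->|//] := eqVneq k i.
  by have [->|//] := eqVneq l j; rewrite Eij.
Qed.

Lemma max_weight_matching_algorithm n (E : {set 'I_n * 'I_n}) (y : matching n) :
  max_weight E y -> matching_algorithm E y.
Proof.
move=> [hs hc] q [j|i].
  case: (hc q j) => [[i [Eij qi _ ->]]|[_ ->]]; last exact: feasible_match0.
  by apply: feasible_match1; rewrite ?ffunE ?eqxx ?addn1 ?ltn_addr.
case: (hs q i) => [[j [Eij qj _ ->]]|[_ ->]]; last exact: feasible_match0.
by apply: feasible_match1; rewrite ?ffunE ?eqxx ?addn1 ?ltn_addr.
Qed.

Section Markov.
Context {R : realType} {n : nat}.

(* [rate q a] is the Poisson rate of the arrivals of type [a] in state [q]. *)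
Implicit Types (rate : state n -> agent n -> R) (y : matching n).

Definition transition_rate rate y (q q' : state n) : R :=
  \sum_(a | next_state y q a == q') rate q a.

Definition stationary rate y (P : probability (state n) R) : Prop :=
  forall q,
    (P [set q] * (\sum_a rate q a)%:E =
     \esum_(q' in setT) (P [set q'] * (transition_rate rate y q' q)%:E))%E.

(* States reached with positive probability from the empty one. Matches occur
   only at arrivals, so under a pricing policy that stops the arrivals at full
   queues the state with all queues full is absorbing for any matching; it has
   to be excluded when it cannot be reached. *)
Inductive reachable rate y : state n -> Prop :=
  | reachable0 : reachable rate y (empty_state n)
  | reachableS q a : reachable rate y q -> 0 < rate q a ->
      reachable rate y (next_state y q a).

End Markov.

Section Fluid.
Context {R : realType} {n : nat}.
Implicit Types (E : {set 'I_n * 'I_n}) (F G : 'I_n -> R -> R).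
Implicit Types (lam mu : 'I_n -> R) (chi : 'M[R]_n).

Definition strictly_convex_nneg (f : R -> R) : Prop :=
  forall x z t : R, 0 <= x -> 0 <= z -> x != z -> 0 < t < 1 ->
    f (t * x + (1 - t) * z) < t * f x + (1 - t) * f z.

Definition strictly_concave_nneg (f : R -> R) : Prop :=
  strictly_convex_nneg (fun x => - f x).

Definition fluid_feasible E lam mu chi : Prop :=
  [/\ forall j, lam j = \sum_i chi i j,
      forall i, mu i = \sum_j chi i j,
      forall i j, (i, j) \in E -> 0 <= chi i j &
      forall i j, (i, j) \notin E -> chi i j = 0].

Definition fluid_profit F G lam mu : R :=
  \sum_j lam j * F j (lam j) - \sum_i mu i * G i (mu i).

Definition fluid_optimal E F G lam mu chi : Prop :=
  fluid_feasible E lam mu chi /\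
  forall lam' mu' chi', fluid_feasible E lam' mu' chi' ->
    fluid_profit F G lam' mu' <= fluid_profit F G lam mu.

Definition complete_resource_pooling E lam mu : Prop :=
  (forall J : {set 'I_n}, J != finset.set0 -> J \proper [set: 'I_n]%SET ->
    \sum_(j in J) lam j < \sum_(i | [exists j in J, (i, j) \in E]) mu i) /\
  (forall I : {set 'I_n}, I != finset.set0 -> I \proper [set: 'I_n]%SET ->
    \sum_(i in I) mu i < \sum_(j | [exists i in I, (i, j) \in E]) lam j).

Definition fluid_pricing (eta K : nat) lam mu (q : state n) (a : agent n) : R :=
  match a with
  | inl j => eta%:R * lam j * (q (inl j) < K)%N%:R
  | inr i => eta%:R * mu i * (q (inr i) < K)%N%:R
  end.

End Fluid.

Definition perfect_matching n (E : {set 'I_n * 'I_n}) : Prop :=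
  exists s : 'S_n, forall i, (i, s i) \in E.

(* Main.v *)
Require Import Defs.
From HB Require Import structures.
From mathcomp Require Import all_boot all_order all_algebra all_fingroup.
From mathcomp Require Import all_classical all_reals all_analysis.
From mathcomp Require Import ring lra.
Set Implicit Arguments.
Unset Strict Implicit.
Unset Printing Implicit Defensive.
Import Order.TTheory GRing.Theory Num.Theory.
Import numFieldNormedType.Exports.
Local Open Scope classical_set_scope.
Local Open Scope ring_scope.

(* The proof tests stationarity against two functions of the state.

   The imbalance z = (waiting customers) - (waiting servers) does not see the
   matches. Testing with z^2 gives L - S = 2 E[z (B - B')], where L is the total
   arrival rate, B and B' are the rates of customers and servers lost at full
   queues and S = E[B + B']. Since |z| <= n K with K = qmax, this yields the
   lower bound.

   For the limit one needs z close to n K when a customer queue is full. With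
   max-weight matching no compatible pair waits, so along the perfect matching
   the state is described by the net queues x_k, customers minus servers, and
   V = sum_k (x_k - mean)^2 has drift at most -2 eps max_k |x_k - mean| + L, the
   losses at full queues only helping. Testing with V^2 bounds E[V]
   independently of eta and K. At a full customer queue, K - z / n is a deviation
   x_k - mean, and AM-GM with weight r = 1 / sqrt K turns the bound on E[V] into
   2 n K S (1 - r) <= L + O(r). *)

(** * Expectations over bounded states *)

(** The states with queues at most [K], indexed by a finite type so that expectations become finite
    sums. *)
Definition of_bounded n K (t : {ffun agent n -> 'I_K.+1}) : state n :=
  [ffun a => t a : nat].

Lemma of_bounded_inj n K : injective (@of_bounded n K).
Proof.
move=> t u /ffunP tu; apply/ffunP => a; apply: val_inj.
by have := tu a; rewrite !ffunE.
Qed.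

Lemma of_bounded_le n K (t : {ffun agent n -> 'I_K.+1}) a :
  (of_bounded t a <= K)%N.
Proof. by rewrite ffunE -ltnS. Qed.

Lemma of_boundedP n K (q : state n) :
  (forall a, (q a <= K)%N) -> exists t, of_bounded (K:=K) t = q.
Proof.
move=> qK; exists [ffun a => inord (q a)]; apply/ffunP => a.
by rewrite !ffunE inordK ?ltnS.
Qed.

(* The expectation of [f] when [P] is carried by the states with queues at most
   [K]; the other states are ignored. *)
Definition expect (R : realType) n K (P : probability (state n) R)
    (f : state n -> R) : R :=
  \sum_(t : {ffun agent n -> 'I_K.+1})
    fine (P [set of_bounded t]) * f (of_bounded t).

Lemma probabilityI1 d (T : measurableType d) (R : realType)
    (P : probability T R) (A B : set T) :
  measurable A -> measurable B -> P A = 1%E -> P (B `&` A) = P B.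
Proof.
move=> mA mB PA; rewrite [RHS](measureDI P mB mA) [X in (X + _)%E](_ : _ = 0%E).
  by rewrite add0e.
apply/eqP; rewrite eq_le measure_ge0 andbT.
have <- : P (~` A) = 0%E by rewrite probability_setC// PA subee.
by apply: le_measure; rewrite ?inE; [exact: measurableD|exact: measurableC|move=> x []].
Qed.

Lemma fine_probability_expect (R : realType) n K (P : probability (state n) R)
    (A : set (state n)) :
  P [set q : state n | forall a, (q a <= K)%N] = 1%E ->
  fine (P A) = expect K P (fun q => (q \in A)%:R).
Proof.
move=> PK; rewrite -(@probabilityI1 _ _ _ P _ A _ _ PK)//.
have -> : A `&` [set q | forall a, (q a <= K)%N] =
    \bigcup_(t in [set` [pred t | of_bounded (K:=K) t \in A]]) [set of_bounded t].
  apply/seteqP; split=> [q [Aq /of_boundedP[t tq]]|q [t /= At ->]].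
    by exists t => //; rewrite /= /in_mem /= tq; exact/mem_set.
  by split; [exact/set_mem|exact: of_bounded_le].
rewrite measure_fin_bigcup//; last first.
  by move=> t u _ _ [q [/= -> /of_bounded_inj]].
rewrite -(bigfs _ (r := index_enum _)) ?index_enum_uniq//; last first.
  by move=> t; rewrite mem_index_enum.
rewrite -sum_fine; last by move=> t _; rewrite fin_num_measure.
rewrite /expect big_mkcond; apply: eq_bigr => t _; rewrite inE.
by case: ifP => _; rewrite ?mulr1 ?mulr0.
Qed.

Lemma expect_eq0 (R : realType) n K (P : probability (state n) R)
    (A : set (state n)) :
  P A = 1%E -> forall t : {ffun agent n -> 'I_K.+1},
  ~ A (of_bounded t) -> fine (P [set of_bounded t]) = 0.
Proof.
move=> PA t nA; rewrite -(@probabilityI1 _ _ _ P _ [set of_bounded t] _ _ PA)//.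
rewrite (_ : _ `&` _ = set0) ?measure0//.
by apply/seteqP; split=> // q [/= ->].
Qed.

Lemma fsbig_setT (R : Type) (idx : R) (op : Monoid.com_law idx) (I : finType)
    (f : I -> R) :
  \big[op/idx]_(i \in [set: I]) f i = \big[op/idx]_i f i.
Proof.
rewrite (_ : [set: I] = [set` xpredT]); last exact/seteqP.
rewrite -(bigfs _ (r := index_enum _)) ?index_enum_uniq//.
by move=> i; rewrite mem_index_enum.
Qed.

Lemma expectD (R : realType) n K (P : probability (state n) R) f g :
  expect K P (fun q => f q + g q) = expect K P f + expect K P g.
Proof. by rewrite -big_split; apply: eq_bigr => t _; rewrite /= mulrDr. Qed.

Lemma expectZ (R : realType) n K (P : probability (state n) R) c f :
  expect K P (fun q => c * f q) = c * expect K P f.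
Proof. by rewrite /expect mulr_sumr; apply: eq_bigr => t _; rewrite mulrCA. Qed.

Lemma expect_sum (R : realType) n K (P : probability (state n) R) (I : finType)
    (f : I -> state n -> R) :
  expect K P (fun q => \sum_i f i q) = \sum_i expect K P (f i).
Proof.
by rewrite /expect exchange_big; apply: eq_bigr => t _; rewrite mulr_sumr.
Qed.

Lemma expect_cst (R : realType) n K (P : probability (state n) R) (c : R) :
  P [set q : state n | forall a, (q a <= K)%N] = 1%E ->
  expect K P (fun=> c) = c.
Proof.
move=> PK; have := fine_probability_expect setT PK.
rewrite probability_setT /expect => /= e1; rewrite -mulr_suml -[RHS]mul1r e1.
by congr (_ * _); apply: eq_bigr => t _; rewrite in_setT mulr1.
Qed.

(** States outside the full-probability event [A] carry no mass, so the comparison may use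
    invariants such as reachability. *)
Lemma le_expect (R : realType) n K (P : probability (state n) R)
    (A : set (state n)) f g :
  P A = 1%E ->
  (forall q, A q -> (forall a, (q a <= K)%N) -> f q <= g q) ->
  expect K P f <= expect K P g.
Proof.
move=> PA fg; apply: ler_sum => t _.
have [At|nAt] := pselect (A (of_bounded t)); last first.
  by rewrite (expect_eq0 PA nAt) !mul0r.
by rewrite ler_wpM2l ?fine_ge0 ?measure_ge0// fg//; exact: of_bounded_le.
Qed.

(** Global balance multiplied by [f] and summed over the states, with the sums exchanged. Everything
    is finite because the rate vanishes at a full queue, so no transition leaves the box. *)
Lemma expect_generator (R : realType) n K (P : probability (state n) R)
    (rate : state n -> agent n -> R) (y : matching n) (f : state n -> R) :
  (forall q a, 0 <= rate q a) ->
  (forall (q : state n) a, (K <= q a)%N -> rate q a = 0) ->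
  stationary rate y P ->
  P [set q : state n | forall a, (q a <= K)%N] = 1%E ->
  expect K P (fun q => \sum_a rate q a * (f (next_state y q a) - f q)) = 0.
Proof.
move=> rate0 rateK statP PK; set p := fun t => fine (P [set @of_bounded n K t]).
have balance (t : {ffun agent n -> 'I_K.+1}) : p t * (\sum_a rate (of_bounded t) a) =
    \sum_u p u * transition_rate rate y (of_bounded u) (of_bounded t).
  have := statP (of_bounded t).
  rewrite -[P [set of_bounded t]]fineK ?fin_num_measure// -EFinM.
  (* States outside the box have probability zero and drop out of the inflow. *)
  have -> : \esum_(q in setT)
      (P [set q] * (transition_rate rate y q (of_bounded t))%:E)%E =
      \esum_(q in @of_bounded n K @` setT)
      (P [set q] * (transition_rate rate y q (of_bounded t))%:E)%E.
    rewrite [RHS]esum_mkcond; apply: eq_esum => q _; case: ifPn => // /negP nq.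
    rewrite [P [set q]](_ : _ = 0%E) ?mul0e//.
    rewrite -(@probabilityI1 _ _ _ P _ [set q] _ _ PK)//.
    rewrite (_ : _ `&` _ = set0) ?measure0//; apply/seteqP; split=> // r [/= ->].
    by move=> /of_boundedP[u uq]; apply: nq; rewrite inE; exists u.
  rewrite esum_image; last by move=> u v _ _; exact: of_bounded_inj.
  rewrite esum_fset; [|exact: finite_finset|]; last first.
    by move=> u _; rewrite mule_ge0// lee_fin sumr_ge0.
  rewrite fsbig_setT.
  under eq_bigr => u _ do
    rewrite -[P [set of_bounded u]]fineK ?fin_num_measure// -EFinM.
  by rewrite sumEFin => -[].
have flow (u : {ffun agent n -> 'I_K.+1}) :
    \sum_(t : {ffun agent n -> 'I_K.+1})
      transition_rate rate y (of_bounded u) (of_bounded t) *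
      f (of_bounded t) =
    \sum_a rate (of_bounded u) a * f (next_state y (of_bounded u) a).
  under eq_bigr => t _ do rewrite /transition_rate big_mkcond mulr_suml.
  rewrite exchange_big; apply: eq_bigr => a _ /=.
  have [uK|/rateK ->] := ltnP (of_bounded u a) K; last first.
    by rewrite mul0r big1// => t _; case: ifP; rewrite mul0r.
  have /of_boundedP[t tq] : forall b, (next_state y (of_bounded u) a b <= K)%N.
    move=> b; rewrite ffunE (leq_trans (leq_subr _ _))// ffunE.
    have [->|_] := eqVneq b a; first by rewrite addn1.
    by rewrite addn0 of_bounded_le.
  rewrite (bigD1 t)//= tq eqxx big1 ?addr0// => v vt.
  by rewrite -tq (inj_eq (@of_bounded_inj n K)) eq_sym (negPf vt) mul0r.
rewrite /expect -/p.
under eq_bigr => t _.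
  under eq_bigr => a _ do rewrite mulrBr.
  rewrite sumrB mulrBr -mulr_suml mulrA balance mulr_suml.
  over.
rewrite sumrB; apply/eqP; rewrite subr_eq0; apply/eqP.
rewrite [RHS]exchange_big; apply: eq_bigr => u _ /=.
rewrite -/(p _) -flow mulr_sumr; apply: eq_bigr => t _.
by rewrite mulrA.
Qed.

(** * The imbalance and the lower bound *)

(** The factor [eta] only rescales time and cancels, so bounds derived from this identity are
    uniform in [eta]. *)
Lemma fluid_generator (R : realType) n eta K (lam mu : 'I_n -> R)
    (y : matching n) (P : probability (state n) R) (f : state n -> R) :
  (0 < eta)%N -> (forall j, 0 < lam j) -> (forall i, 0 < mu i) ->
  stationary (fluid_pricing eta K lam mu) y P ->
  P [set q : state n | forall a, (q a <= K)%N] = 1%E ->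
  expect K P (fun q =>
    \sum_j lam j * (q (inl j) < K)%N%:R * (f (next_state y q (inl j)) - f q) +
    \sum_i mu i * (q (inr i) < K)%N%:R * (f (next_state y q (inr i)) - f q))
  = 0.
Proof.
move=> eta0 lam0 mu0 statP PK.
have rate0 q a : 0 <= fluid_pricing eta K lam mu q a.
  by case: a => k; rewrite !mulr_ge0// ltW.
have rateK (q : state n) a :
    (K <= q a)%N -> fluid_pricing eta K lam mu q a = 0.
  by case: a => k; rewrite leqNgt => /negPf /= ->; rewrite mulr0.
have := expect_generator f rate0 rateK statP PK.
rewrite (_ : expect K P _ = eta%:R * expect K P (fun q =>
  \sum_j lam j * (q (inl j) < K)%N%:R * (f (next_state y q (inl j)) - f q) +
  \sum_i mu i * (q (inr i) < K)%N%:R * (f (next_state y q (inr i)) - f q))).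
  by move/eqP; rewrite mulf_eq0 pnatr_eq0 (gtn_eqF eta0) => /eqP.
rewrite -expectZ; apply: eq_bigr => t _; congr (_ * _).
by rewrite big_sumType mulrDr !mulr_sumr; congr (_ + _); apply: eq_bigr => k _;
  rewrite /= !mulrA.
Qed.

Definition imbalance (R : realType) n (q : state n) : R :=
  \sum_j (q (inl j))%:R - \sum_i (q (inr i))%:R.

Lemma imbalance_le (R : realType) n K (q : state n) :
  (forall a, (q a <= K)%N) -> `|imbalance R q| <= n%:R * K%:R.
Proof.
move=> qK.
have side (f : 'I_n -> agent n) :
    0 <= (\sum_i (q (f i))%:R : R) <= n%:R * K%:R.
  rewrite sumr_ge0//= -natr_sum -natrM ler_nat.
  by rewrite (leq_trans (leq_sum _ (fun i _ => qK (f i))))// sum_nat_const card_ord.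
rewrite ler_norml /imbalance.
have /andP[] := side inl; have /andP[] := side inr; lra.
Qed.

(** Each match removes one customer and one server, and feasibility makes the truncated subtractions
    exact, so only the arrival itself is seen. *)
Lemma imbalance_next (R : realType) n (E : {set 'I_n * 'I_n}) (y : matching n)
    (q : state n) a :
  matching_algorithm E y ->
  imbalance R (next_state y q a) = imbalance R q + (if a is inl _ then 1 else -1).
Proof.
move=> /(_ q a)[yc ys _].
have sum_add (f : 'I_n -> agent n) : injective f ->
    \sum_i (add_agent q a (f i))%:R =
    \sum_i (q (f i))%:R + [exists i, f i == a]%:R :> R.
  move=> finj; under eq_bigr => i _ do rewrite ffunE natrD.
  rewrite big_split/=; congr (_ + _).
  have [/existsP[i /eqP fi]|/existsPn nf] := boolP [exists i, f i == a].
    by rewrite (bigD1 i)//= fi eqxx big1 ?addr0// => k /negPf ki; rewrite -fi (inj_eq finj) ki.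
  by rewrite big1// => i _; rewrite (negPf (nf i)).
rewrite /imbalance.
under eq_bigr => j _ do rewrite ffunE natrB//.
under [X in _ - X]eq_bigr => j _ do rewrite ffunE natrB//.
rewrite !sumrB sum_add; last by move=> ? ? [].
rewrite sum_add; last by move=> ? ? [].
have -> : \sum_j (\sum_i y q a i j)%N%:R = \sum_i (\sum_j y q a i j)%N%:R :> R.
  by rewrite -!natr_sum exchange_big.
case: a {yc ys sum_add} => k /=.
  rewrite (_ : [exists i, inl i == _] = true); last by apply/existsP; exists k.
  rewrite (_ : [exists i, inr i == _] = false); last by apply/existsP => -[].
  by rewrite mulr0n mulr1n; ring.
rewrite (_ : [exists i, inr i == _] = true); last by apply/existsP; exists k.
rewrite (_ : [exists i, inl i == _] = false); last by apply/existsP => -[].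
by rewrite mulr0n mulr1n; ring.
Qed.

(** Loss rate at the full queues of one side, in units of [eta]: B is the case of [lam] and [inl],
    B' that of [mu] and [inr]. *)
Definition blocked (R : realType) n K (w : 'I_n -> R) (f : 'I_n -> agent n)
    (q : state n) : R := \sum_i w i * (q (f i) == K)%:R.

Lemma blocked_ge0 (R : realType) n K (w : 'I_n -> R) f q :
  (forall i, 0 < w i) -> 0 <= blocked K w f q.
Proof. by move=> w0; apply: sumr_ge0 => i _; rewrite mulr_ge0// ltW. Qed.

Lemma sum_unblocked (R : realType) n K (w : 'I_n -> R) (f : 'I_n -> agent n)
    (q : state n) (g : 'I_n -> R) :
  (forall a, (q a <= K)%N) ->
  \sum_i w i * (q (f i) < K)%N%:R * g i =
  \sum_i w i * g i - \sum_i w i * (q (f i) == K)%:R * g i.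
Proof.
move=> qK; rewrite -sumrB; apply: eq_bigr => i _.
by rewrite ltn_neqAle qK andbT; case: eqP => _ /=; ring.
Qed.

Lemma expect_blocked (R : realType) n K (w : 'I_n -> R) (f : 'I_n -> agent n)
    (P : probability (state n) R) :
  P [set q : state n | forall a, (q a <= K)%N] = 1%E ->
  expect K P (blocked K w f) =
  \sum_i w i * fine (P [set q : state n | q (f i) = K]).
Proof.
move=> PK; rewrite expect_sum; apply: eq_bigr => i _.
rewrite expectZ (fine_probability_expect _ PK); congr (_ * _).
apply: eq_bigr => t _; congr (_ * (nat_of_bool _)%:R).
by apply/idP/idP => [/eqP|/set_mem/eqP//] qK; apply/mem_set.
Qed.

(* Stationarity of the squared imbalance, whose jumps do not depend on the
   matching. *)
Lemma expect_imbalance (R : realType) n (E : {set 'I_n * 'I_n}) eta K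
    (lam mu : 'I_n -> R) (y : matching n) (P : probability (state n) R) :
  (0 < eta)%N -> (forall j, 0 < lam j) -> (forall i, 0 < mu i) ->
  \sum_j lam j = \sum_i mu i -> matching_algorithm E y ->
  stationary (fluid_pricing eta K lam mu) y P ->
  P [set q : state n | forall a, (q a <= K)%N] = 1%E ->
  2 * expect K P (fun q => imbalance R q *
    (blocked K lam inl q - blocked K mu inr q)) +
  (\sum_j lam j * fine (P [set q : state n | q (inl j) = K]) +
   \sum_i mu i * fine (P [set q : state n | q (inr i) = K])) =
  \sum_j lam j + \sum_i mu i.
Proof.
move=> eta0 lam0 mu0 lammu yE statP PK.
have := fluid_generator (fun q => imbalance R q ^+ 2) eta0 lam0 mu0 statP PK.
set f := (X in expect K P X) => Ef.
rewrite -!expect_blocked// -expectZ -!expectD -[RHS](expect_cst _ PK).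
(* Subtracting [f], of expectation zero, leaves a pointwise identity; its term 2 z (sum of [lam] -
   sum of [mu]) vanishes by [lammu]. *)
transitivity (expect K P (fun q => \sum_j lam j + \sum_i mu i + -1 * f q));
  last by rewrite expectD expectZ Ef mulr0 addr0.
apply: eq_bigr => t _; congr (_ * _).
have tK := of_bounded_le t; move: (of_bounded t) tK => q qK.
rewrite /f !sum_unblocked//.
have next w (h : 'I_n -> agent n) :
    \sum_i w i * (imbalance R (next_state y q (h i)) ^+ 2 - imbalance R q ^+ 2) =
    \sum_i w i * ((imbalance R q + (if h i is inl _ then 1 else -1)) ^+ 2 -
      imbalance R q ^+ 2).
  by apply: eq_bigr => i _; rewrite (imbalance_next _ _ _ yE).
rewrite !next /= -!mulr_suml -/(blocked _ _ _ _) -/(blocked _ _ _ _) lammu; ring.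
Qed.

(** Pointwise z (B - B') <= n K (B + B'), so [expect_imbalance] gives L <= (2 n K + 1) S; then
    factor out K. *)
Lemma blocked_lower_bound (R : realType) n (E : {set 'I_n * 'I_n}) eta K
    (lam mu : 'I_n -> R) (y : matching n) (P : probability (state n) R) :
  (0 < eta)%N -> (0 < K)%N -> (forall j, 0 < lam j) -> (forall i, 0 < mu i) ->
  \sum_j lam j = \sum_i mu i -> matching_algorithm E y ->
  stationary (fluid_pricing eta K lam mu) y P ->
  P [set q : state n | forall a, (q a <= K)%N] = 1%E ->
  (\sum_j lam j + \sum_i mu i) / (2 * n%:R + 1 / K%:R) <=
  K%:R * (\sum_j lam j * fine (P [set q : state n | q (inl j) = K]) +
          \sum_i mu i * fine (P [set q : state n | q (inr i) = K])).
Proof.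
move=> eta0 K0 lam0 mu0 lammu yE statP PK.
have := expect_imbalance eta0 lam0 mu0 lammu yE statP PK.
rewrite -!expect_blocked// -expectD; set S := expect K P (fun q => _ + _) => id.
have : expect K P (fun q => imbalance R q *
    (blocked K lam inl q - blocked K mu inr q)) <= n%:R * K%:R * S.
  rewrite -expectZ; apply: (le_expect PK) => q _ /(imbalance_le R).
  have := @blocked_ge0 _ _ K lam inl q lam0.
  have := @blocked_ge0 _ _ K mu inr q mu0.
  by rewrite ler_norml => b0 c0 /andP[zl zu]; nra.
have K0' : 0 < K%:R :> R by rewrite ltr0n.
have n0 : 0 <= n%:R :> R by [].
rewrite ler_pdivrMr; last by rewrite ltr_wpDl// ?mulr_ge0// divr_gt0.
rewrite -id => le1.
have -> : K%:R * S * (2 * n%:R + 1 / K%:R) = 2 * (n%:R * K%:R * S) + S.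
  by field; rewrite gt_eqF.
by rewrite lerD2r ler_wpM2l.
Qed.

(** * Max-weight dynamics of the net queues *)

Definition no_waiting_pair n (E : {set 'I_n * 'I_n}) (q : state n) : Prop :=
  forall i j, (i, j) \in E -> q (inr i) = 0%N \/ q (inl j) = 0%N.

Lemma sum_delta_mx_col n (i j k : 'I_n) :
  (\sum_l (delta_mx i j : 'M[nat]_n) l k = (k == j))%N.
Proof.
rewrite (bigD1 i)//= big1 ?mxE ?eqxx ?addn0/=; first by case: (k == j).
by move=> l /negPf li; rewrite mxE li.
Qed.

Lemma sum_delta_mx_row n (i j k : 'I_n) :
  (\sum_l (delta_mx i j : 'M[nat]_n) k l = (k == i))%N.
Proof.
rewrite (bigD1 j)//= big1 ?mxE ?eqxx ?addn0 ?andbT/=; first by case: (k == i).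
by move=> l /negPf lj; rewrite mxE lj andbF.
Qed.

Lemma remove_match0 n (q : state n) : remove_match q (const_mx 0%N) = q.
Proof.
apply/ffunP => -[k|k]; rewrite ffunE big1 ?subn0// => l _; exact: mxE.
Qed.

Lemma next_state_server n (E : {set 'I_n * 'I_n}) (y : matching n)
    (q : state n) i :
  max_weight E y ->
  (exists j, [/\ (i, j) \in E, (0 < q (inl j))%N,
     q (inl j) = \max_(k | (i, k) \in E) q (inl k) &
     next_state y q (inr i) = [ffun b => q b - (b == inl j)]%N]) \/
  ((forall j, (i, j) \in E -> q (inl j) = 0%N) /\
   next_state y q (inr i) = add_agent q (inr i)).
Proof.
move=> [/(_ q i)[[j [Eij qj jmax yE]]|[q0 yE]] _]; [left|right]; last first.
  by split=> //; rewrite /next_state yE remove_match0.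
exists j; split=> //.
  by apply/eqP; rewrite eqn_leq (leq_bigmax_cond j)//=; apply/bigmax_leqP.
apply/ffunP => -[k|k]; rewrite /next_state yE !ffunE.
  by rewrite sum_delta_mx_col/= addn0.
by rewrite sum_delta_mx_row/= addnK subn0.
Qed.

Lemma next_state_customer n (E : {set 'I_n * 'I_n}) (y : matching n)
    (q : state n) j :
  max_weight E y ->
  (exists i, [/\ (i, j) \in E, (0 < q (inr i))%N,
     q (inr i) = \max_(k | (k, j) \in E) q (inr k) &
     next_state y q (inl j) = [ffun b => q b - (b == inr i)]%N]) \/
  ((forall i, (i, j) \in E -> q (inr i) = 0%N) /\
   next_state y q (inl j) = add_agent q (inl j)).
Proof.
move=> [_ /(_ q j)[[i [Eij qi imax yE]]|[q0 yE]]]; [left|right]; last first.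
  by split=> //; rewrite /next_state yE remove_match0.
exists i; split=> //.
  by apply/eqP; rewrite eqn_leq (leq_bigmax_cond i)//=; apply/bigmax_leqP.
apply/ffunP => -[k|k]; rewrite /next_state yE !ffunE.
  by rewrite sum_delta_mx_col/= addnK subn0.
by rewrite sum_delta_mx_row/= addn0.
Qed.

(** A match only shortens a queue, and an agent joins its own queue only when all compatible queues
    are empty. *)
Lemma reachable_no_waiting_pair (R : realType) n (E : {set 'I_n * 'I_n})
    (rate : state n -> agent n -> R) (y : matching n)
    (q : state n) :
  max_weight E y -> reachable rate y q -> no_waiting_pair E q.
Proof.
move=> yE; elim=> [|{}q a _ qE _ i j Eij]; first by left; rewrite ffunE.
case: a => k.
  case: (next_state_customer q k yE) => [[l [_ _ _ ->]]|[q0 ->]]; rewrite !ffunE.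
    by case: (qE _ _ Eij) => ->; [left|right].
  rewrite /= addn0; have [jk|jk] := eqVneq j k.
    by left; apply: q0; rewrite -jk.
  by case: (qE _ _ Eij) => ->; [left|right]; rewrite // eqE/= (negPf jk).
case: (next_state_server q k yE) => [[l [_ _ _ ->]]|[q0 ->]]; rewrite !ffunE.
  by case: (qE _ _ Eij) => ->; [left|right].
rewrite /= addn0; have [ik|ik] := eqVneq i k.
  by right; apply: q0; rewrite -ik.
by case: (qE _ _ Eij) => ->; [left|right]; rewrite // eqE/= (negPf ik).
Qed.

Lemma reachable_le (R : realType) n eta K (lam mu : 'I_n -> R) (y : matching n)
    (q : state n) :
  reachable (fluid_pricing eta K lam mu) y q -> forall a, (q a <= K)%N.
Proof.
elim=> [|{}q a _ qK rate0] b; first by rewrite ffunE.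
have qaK : (q a < K)%N.
  rewrite ltnNge; apply/negP => /leq_gtF qa.
  by case: a qa rate0 => k /= ->; rewrite mulr0 ltxx.
rewrite ffunE (leq_trans (leq_subr _ _))// ffunE.
by have [->|_] := eqVneq b a; rewrite ?addn1// addn0.
Qed.

(** When no compatible pair waits, one of the two partner queues is empty, so the difference
    determines both. *)
Definition net_queue (R : realType) n (s : 'S_n) (q : state n) (k : 'I_n) : R :=
  (q (inl (s k)))%:R - (q (inr k))%:R.

Lemma sum_net_queue (R : realType) n (s : 'S_n) (q : state n) :
  \sum_k net_queue R s q k = imbalance R q.
Proof.
rewrite sumrB /imbalance; congr (_ - _).
by rewrite [RHS](reindex_inj (@perm_inj _ s)).
Qed.

(* Whether the arrival is matched or not, exactly one net queue moves, and its
   value is the quantity that max-weight optimizes. *)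
Lemma net_queue_server (R : realType) n (E : {set 'I_n * 'I_n}) (s : 'S_n)
    (y : matching n)
    (q : state n) i :
  (forall k, (k, s k) \in E) -> max_weight E y -> no_waiting_pair E q ->
  exists k, net_queue R s q k =
      (\max_(j | (i, j) \in E) q (inl j))%:R - (q (inr i))%:R /\
    forall l, net_queue R s (next_state y q (inr i)) l =
      net_queue R s q l + -1 * (l == k)%:R.
Proof.
move=> sE yE qE.
case: (next_state_server q i yE) => [[j [Eij qj jmax ->]]|[q0 ->]].
  (* The net queue that moves belongs to the partner of the matched type [j], not to [i]. Customers
     of type [j] wait, so the queues of both server types are empty. *)
  exists ((s^-1)%g j); have j0 := gtn_eqF qj.
  have qs k : (k, j) \in E -> q (inr k) = 0%N.
    by move=> /qE[//|/eqP]; rewrite j0.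
  have sj : ((s^-1)%g j, j) \in E by have := sE ((s^-1)%g j); rewrite permKV.
  split=> [|l]; first by rewrite /net_queue permKV -jmax !qs.
  rewrite /net_queue !ffunE /= subn0.
  have [->|ls] := eqVneq l ((s^-1)%g j).
    by rewrite permKV eqxx natrB//; ring.
  rewrite (_ : inl (s l) == inl j = false) ?subn0; first by rewrite mulr0n; ring.
  apply/negP => /eqP[slj]; move/eqP: ls; apply; by rewrite -slj permK.
exists i; rewrite big1//; split=> [|l].
  by rewrite /net_queue q0.
rewrite /net_queue !ffunE /= addn0 natrD.
by rewrite (inj_eq (@inr_inj _ _)); ring.
Qed.

Lemma net_queue_customer (R : realType) n (E : {set 'I_n * 'I_n}) (s : 'S_n)
    (y : matching n)
    (q : state n) j :
  (forall k, (k, s k) \in E) -> max_weight E y -> no_waiting_pair E q ->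
  exists k, net_queue R s q k =
      (q (inl j))%:R - (\max_(i | (i, j) \in E) q (inr i))%:R /\
    forall l, net_queue R s (next_state y q (inl j)) l =
      net_queue R s q l + 1 * (l == k)%:R.
Proof.
move=> sE yE qE.
case: (next_state_customer q j yE) => [[i [Eij qi imax ->]]|[q0 ->]].
  exists i; have i0 := gtn_eqF qi.
  have qs k : (i, k) \in E -> q (inl k) = 0%N.
    by move=> /qE[/eqP|//]; rewrite i0.
  split=> [|l]; first by rewrite /net_queue -imax !qs.
  rewrite /net_queue !ffunE /= subn0 (inj_eq (@inr_inj _ _)).
  have [->|_] := eqVneq l i; first by rewrite natrB//; ring.
  by rewrite subn0 mulr0n; ring.
have sj : ((s^-1)%g j, j) \in E by have := sE ((s^-1)%g j); rewrite permKV.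
exists ((s^-1)%g j); rewrite big1//; split=> [|l].
  by rewrite /net_queue permKV q0.
rewrite /net_queue !ffunE /= addn0 natrD (inj_eq (@inl_inj _ _)).
by rewrite -(inj_eq (@perm_inj _ s) l) permKV; ring.
Qed.

(** * Deviations of the net queues from their mean *)

Definition centered (R : realType) n (x : 'I_n -> R) (k : 'I_n) : R :=
  x k - (\sum_l x l) / n%:R.

Definition spread (R : realType) n (x : 'I_n -> R) : R :=
  \sum_k centered x k ^+ 2.

Lemma centered_sqr_le (R : realType) n (x : 'I_n -> R) k :
  centered x k ^+ 2 <= spread x.
Proof.
by rewrite /spread (bigD1 k)//= lerDl sumr_ge0// => l _; exact: sqr_ge0.
Qed.

Lemma spreadE (R : realType) n (x : 'I_n -> R) :
  (0 < n)%N -> spread x = \sum_k x k ^+ 2 - (\sum_k x k) ^+ 2 / n%:R.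
Proof.
move=> n0; rewrite /spread /centered; set m := _ / _.
under eq_bigr => k _ do rewrite sqrrB.
rewrite !big_split/= sumrN sumrMnl -mulr_suml sumr_const card_ord -mulr_natr.
rewrite /m; field; rewrite pnatr_eq0 -lt0n//.
Qed.

(** In the variance formula [spreadE], the linear changes of the sum of squares and of the squared
    sum combine into the deviation at [k]. *)
Lemma spread_shift (R : realType) n (x z : 'I_n -> R) (c : R) k :
  (forall l, z l = x l + c * (l == k)%:R) ->
  spread z - spread x = 2 * c * centered x k + c ^+ 2 * (1 - n%:R^-1).
Proof.
move=> zE; have n0 : (0 < n)%N by case: n k {x z zE} => [[]|].
have ind (w : 'I_n -> R) : \sum_l w l * (l == k)%:R = w k.
  rewrite (bigD1 k)//= eqxx mulr1 big1 ?addr0// => l /negPf ->.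
  by rewrite mulr0.
have sz : \sum_l z l = \sum_l x l + c.
  under eq_bigr => l _ do rewrite zE.
  by rewrite big_split/= (ind (fun=> c)).
have sz2 : \sum_l z l ^+ 2 = \sum_l x l ^+ 2 + (2 * c * x k + c ^+ 2).
  rewrite -(ind (fun l => 2 * c * x l + c ^+ 2)) -big_split/=.
  by apply: eq_bigr => l _; rewrite zE; case: (l == k) => /=; ring.
rewrite !spreadE// sz sz2 /centered; field; rewrite pnatr_eq0 -lt0n//.
Qed.

(** * Negative drift from complete resource pooling *)

Lemma sum_layers m B : (m <= B)%N -> (\sum_(t < B) (t < m)%N)%N = m.
Proof.
move=> mB; rewrite -[RHS](card_ord m) -sum1_card.
rewrite (big_ord_widen _ (fun=> 1%N) mB) [RHS]big_mkcond/=.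
by apply: eq_bigr => t _; case: ltnP.
Qed.

(* Layer-cake decomposition of [g]: the pooling condition is applied to each of
   the level sets [t < g]. *)
Lemma pooling_drift (R : realType) n (e : rel 'I_n) (w v : 'I_n -> R)
    (eps : R) (g : 'I_n -> nat) a b :
  0 <= eps -> \sum_j w j = \sum_i v i -> (forall i, exists j, e j i) ->
  (forall J : {set 'I_n}, J != finset.set0 -> J \proper [set: 'I_n]%SET ->
    \sum_(j in J) w j + eps <= \sum_(i | [exists j in J, e j i]) v i) ->
  \sum_j w j * (g j)%:R - \sum_i v i * (\max_(j | e j i) g j)%:R <=
  - eps * ((g a)%:R - (g b)%:R).
Proof.
move=> eps0 wv epart pool; set B := \max_j g j.
have gB j : (g j <= B)%N by exact: leq_bigmax.
have MB i : (\max_(j | e j i) g j <= B)%N.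
  by apply/bigmax_leqP => j _; exact: gB.
have layers m : (m <= B)%N -> m%:R = \sum_(t < B) (t < m)%N%:R :> R.
  by move=> mB; rewrite -natr_sum sum_layers.
have sumlayers (u : 'I_n -> R) (h : 'I_n -> nat) : (forall i, (h i <= B)%N) ->
    \sum_i u i * (h i)%:R = \sum_(t < B) \sum_(i | (t < h i)%N) u i.
  move=> hB; under eq_bigr => i _ do rewrite (layers _ (hB i)) mulr_sumr.
  rewrite exchange_big; apply: eq_bigr => t _; rewrite [RHS]big_mkcond.
  by apply: eq_bigr => i _ /=; case: ltnP; rewrite ?mulr1 ?mulr0.
rewrite !sumlayers// (layers _ (gB a)) (layers _ (gB b)) -!sumrB mulr_sumr.
apply: ler_sum => t _; pose J := [set j | (t < g j)%N]%SET.
have -> : \sum_(j | (t < g j)%N) w j = \sum_(j in J) w j.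
  by apply: eq_bigl => j; rewrite inE.
(* A maximum over neighbours exceeds [t] exactly when some neighbour lies in the level set [J]. *)
have -> : \sum_(i | (t < \max_(j | e j i) g j)%N) v i =
    \sum_(i | [exists j in J, e j i]) v i.
  apply: eq_bigl => i; rewrite ltnNge; apply/negP/existsP => [/negP|].
    rewrite -ltnNge => lt; apply: contrapT => noj.
    suff : (\max_(j | e j i) g j <= t)%N by rewrite leqNgt lt.
    apply/bigmax_leqP => j eji; rewrite leqNgt; apply/negP => tj.
    by apply: noj; exists j; rewrite inE tj.
  move=> [j /andP[]]; rewrite inE => tj eji /bigmax_leqP/(_ j eji).
  by rewrite leqNgt tj.
(* For an empty or full level set both sides vanish: the indicators at [a] and [b] agree, and a full
   set has all of the [v] side as neighbours, with equal totals. *)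
have [J0|J0] := eqVneq J finset.set0.
  have out j : (t < g j)%N = false.
    by have := finset.in_set0 j; rewrite -J0 inE.
  rewrite J0 big_set0 big_pred0; first by rewrite !out !subrr mulr0.
  by move=> i; apply/existsP => -[j]; rewrite inE.
have [JT|JT] := eqVneq J [set: 'I_n]%SET.
  have out j : (t < g j)%N = true.
    by have := finset.in_setT j; rewrite -JT inE.
  rewrite !out subrr mulr0.
  rewrite (eq_bigl xpredT) ?wv; last by move=> j; rewrite inE out.
  rewrite [X in _ - X](eq_bigl xpredT) ?subrr// => i; apply/existsP.
  by have [j eji] := epart i; exists j; rewrite inE out.
(* The layer gains [eps], and the indicators at [a] and [b] differ by at most 1. *)
have := pool J J0; rewrite properT => /(_ JT).
by case: (t < g a)%N; case: (t < g b)%N => /=; lra.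
Qed.

Lemma pos_lower_bound (R : realType) (T : finType) (Q : pred T) (f : T -> R) :
  (forall x, Q x -> 0 < f x) ->
  exists2 eps : R, 0 < eps & forall x, Q x -> eps <= f x.
Proof.
(* The default 1 keeps the minimum positive when [Q] is empty. *)
move=> f0; exists (\big[Order.min/1]_(x | Q x) f x).
  by elim/big_ind: _ => // u z u0 z0; rewrite lt_min u0.
by move=> x Qx; rewrite (bigD1 x)//= ge_min lexx.
Qed.

(** There are finitely many sets [J], so the strict inequalities share a margin. *)
Lemma pooling_gap (R : realType) n (e : rel 'I_n) (w v : 'I_n -> R) :
  (forall J : {set 'I_n}, J != finset.set0 -> J \proper [set: 'I_n]%SET ->
    \sum_(j in J) w j < \sum_(i | [exists j in J, e j i]) v i) ->
  exists2 eps : R, 0 < eps & forall J : {set 'I_n}, J != finset.set0 ->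
    J \proper [set: 'I_n]%SET ->
    \sum_(j in J) w j + eps <= \sum_(i | [exists j in J, e j i]) v i.
Proof.
move=> pool.
have [//|eps eps0 epsJ] := @pos_lower_bound R {set 'I_n}
    (fun J => (J != finset.set0) && (J \proper [set: 'I_n]%SET))
    (fun J => \sum_(i | [exists j in J, e j i]) v i - \sum_(j in J) w j).
  by move=> J /andP[J0 JT]; rewrite subr_gt0 pool.
exists eps => // J J0 JT; have := epsJ J; rewrite J0 JT => /(_ isT); lra.
Qed.

(** * State space collapse and the upper bound *)

(** [V] and [W] stand for the spread before and after a jump [c] of one net queue with deviation
    [d]; [kappa] is 1 - 1/n. *)
Lemma sqr_step_le (R : realType) (V W d c kappa : R) :
  0 <= V -> d ^+ 2 <= V -> c ^+ 2 = 1 -> 0 <= kappa <= 1 ->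
  W - V = 2 * c * d + c ^+ 2 * kappa ->
  W ^+ 2 - V ^+ 2 <= 4 * V * (c * d) + 10 * V + 2.
Proof.
move=> V0 dV c1 /andP[k0 k1]; rewrite c1 mul1r => /eqP; rewrite subr_eq => /eqP ->.
set e := c * d; have eV : e ^+ 2 <= V by rewrite exprMn c1 mul1r.
have -> : (2 * c * d + kappa + V) ^+ 2 - V ^+ 2 =
    2 * V * (2 * e + kappa) + (2 * e + kappa) ^+ 2 by rewrite /e; ring.
have Vk : V * kappa <= V by rewrite ler_piMr.
have kk : kappa ^+ 2 <= 1 by rewrite exprn_ile1.
(* This square gives (2 e + kappa)^2 <= 8 e^2 + 2 kappa^2 <= 8 V + 2; the other 2 V comes from 2 V
   kappa. *)
have := sqr_ge0 (2 * e - kappa); nra.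
Qed.

(** The first term is at most -4 eps |d|^3, which beats (10 L + 1) d^2 once |d| exceeds the
    threshold (10 L + 1) / (4 eps); below it a constant suffices. *)
Lemma cubic_absorption (R : realType) (A L d eps : R) :
  0 < eps -> 0 <= L -> A <= - eps * `|d| ->
  4 * d ^+ 2 * A + 10 * L * d ^+ 2 <=
  - d ^+ 2 + 4 * eps * ((10 * L + 1) / (4 * eps)) ^+ 3.
Proof.
move=> eps0 L0; rewrite -[d ^+ 2]real_normK ?num_real//.
move: `|d| (normr_ge0 d) => u u0 Au; set c := _ / _.
have c0 : 0 < c by rewrite divr_gt0; lra.
have ec : 4 * eps * c = 10 * L + 1 by rewrite /c; field; rewrite gt_eqF.
have cube : c * u ^+ 2 <= u ^+ 3 + c ^+ 3.
  have [uc|cu] := leP u c.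
    rewrite -[leLHS]add0r lerD ?exprn_ge0// [leRHS]exprS ler_wpM2l ?(ltW c0)//.
    by rewrite lerXn2r// nnegrE ltW.
  rewrite -[leLHS]addr0 lerD ?exprn_ge0 ?(ltW c0)// [leRHS]exprS.
  by rewrite ler_wpM2r ?exprn_ge0 ?(ltW cu).
have uA : u ^+ 2 * A <= u ^+ 2 * (- eps * u) by rewrite ler_wpM2l ?exprn_ge0.
have : 4 * eps * (c * u ^+ 2) <= 4 * eps * (u ^+ 3 + c ^+ 3).
  by rewrite ler_wpM2l// mulr_ge0// ltW.
rewrite mulrA ec; nra.
Qed.

(** A deviation from the mean is the average over [l] of [x k - x l]; exchanging [k] and [l] gives
    the other sign. *)
Lemma centered_drift_le (R : realType) n (x : 'I_n -> R) (A eps : R) :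
  (forall k l, A <= - eps * (x k - x l)) ->
  forall k, A <= - eps * centered x k /\ A <= eps * centered x k.
Proof.
move=> Ax k; have n0 : 0 < n%:R :> R by rewrite ltr0n; case: n k {x Ax} => [[]|].
have avg (c : R) : n%:R * c = \sum_(l < n) c.
  by rewrite sumr_const card_ord -[RHS]mulr_natl.
have cE : n%:R * centered x k = \sum_l (x k - x l).
  by rewrite /centered sumrB -avg; field; rewrite gt_eqF.
have mul c : A <= c * centered x k <-> \sum_(l < n) A <= \sum_l c * (x k - x l).
  by rewrite -mulr_sumr -cE -avg mulrCA ler_pM2l.
by split; apply/mul; apply: ler_sum => l _; [|have := Ax l k; nra]; exact: Ax.
Qed.

(* The [n] terms of [cubic_absorption] plus the second-order term of
   [sqr_step_le]. *)
Definition spread_bound (R : realType) n (L eps : R) : R :=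
  n%:R * (4 * eps * ((10 * L + 1) / (4 * eps)) ^+ 3) + 2 * L.

(** The drift is at most 4 V A + 10 L V + 2 L with A the max-weight drift. Splitting V into its
    squared deviations, [cubic_absorption] turns each share into minus itself plus a constant. *)
Lemma spread_sqr_drift (R : realType) n (E : {set 'I_n * 'I_n}) (s : 'S_n) K
    (lam mu : 'I_n -> R) (eps : R) (y : matching n) (q : state n) :
  (0 < K)%N -> (forall j, 0 < lam j) -> (forall i, 0 < mu i) ->
  \sum_j lam j = \sum_i mu i -> (forall k, (k, s k) \in E) -> 0 < eps ->
  (forall J : {set 'I_n}, J != finset.set0 -> J \proper [set: 'I_n]%SET ->
    \sum_(j in J) lam j + eps <= \sum_(i | [exists j in J, (i, j) \in E]) mu i) ->
  (forall I : {set 'I_n}, I != finset.set0 -> I \proper [set: 'I_n]%SET ->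
    \sum_(i in I) mu i + eps <= \sum_(j | [exists i in I, (i, j) \in E]) lam j) ->
  max_weight E y -> no_waiting_pair E q -> (forall a, (q a <= K)%N) ->
  \sum_j lam j * (q (inl j) < K)%N%:R *
    (spread (net_queue R s (next_state y q (inl j))) ^+ 2 -
     spread (net_queue R s q) ^+ 2) +
  \sum_i mu i * (q (inr i) < K)%N%:R *
    (spread (net_queue R s (next_state y q (inr i))) ^+ 2 -
     spread (net_queue R s q) ^+ 2) <=
  spread_bound n (\sum_j lam j + \sum_i mu i) eps +
  -1 * spread (net_queue R s q).
Proof.
move=> K0 lam0 mu0 lammu sE eps0 poolc pools yE qE qK.
set L := \sum_j lam j + \sum_i mu i; rewrite /spread_bound.
pose V q := spread (net_queue R s q); rewrite -!/(V _).
have [n0|n0] := posnP n.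
  have no (i : 'I_n) : False by case: i => m; rewrite n0.
  rewrite /V /spread /L !big1; try by move=> i; case: (no i).
  rewrite n0 mul0r; clear no; lra.
set x := net_queue R s q; pose m := imbalance R q / n%:R.
have nR : 0 < n%:R :> R by rewrite ltr0n.
have mK : - K%:R <= m <= K%:R.
  have := imbalance_le R qK.
  by rewrite ler_norml ler_pdivlMr// ler_pdivrMr// mulNr ![_ * n%:R]mulrC.
have xm k : centered x k = x k - m by rewrite /centered sum_net_queue.
have V0 : 0 <= V q by apply: sumr_ge0 => k _; exact: sqr_ge0.
have kappa01 : 0 <= (1 - n%:R^-1 : R) <= 1.
  by rewrite subr_ge0 invf_le1// ler1n n0 gerBl invr_ge0 ltW.
pose Mc i : R := (\max_(j | (i, j) \in E) q (inl j))%:R.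
pose Ms j : R := (\max_(i | (i, j) \in E) q (inr i))%:R.
(* At a full queue the left-hand side vanishes, while [Ms j = 0] and [m <= K]
   make the right-hand side nonnegative. *)
have custE j : lam j * (q (inl j) < K)%N%:R *
      (V (next_state y q (inl j)) ^+ 2 - V q ^+ 2) <=
    lam j * (4 * V q * ((q (inl j))%:R - Ms j - m) + 10 * V q + 2).
  rewrite -mulrA ler_wpM2l ?(ltW (lam0 _))//.
  have [k [xk /spread_shift shift]] := net_queue_customer R j sE yE qE.
  have [qjK|qjK] := ltnP.
    have := sqr_step_le V0 (centered_sqr_le x k) (expr1n _ 2) kappa01 shift.
    by rewrite !mul1r xm /x xk.
  have jK : q (inl j) = K by apply/eqP; rewrite eqn_leq qK.
  have -> : Ms j = 0.
    rewrite /Ms big1// => i /qE[//|/eqP]; by rewrite jK (gtn_eqF K0).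
  by rewrite mul0r jK; case/andP: mK => ? ?; nra.
have servE i : mu i * (q (inr i) < K)%N%:R *
      (V (next_state y q (inr i)) ^+ 2 - V q ^+ 2) <=
    mu i * (4 * V q * ((q (inr i))%:R - Mc i + m) + 10 * V q + 2).
  rewrite -mulrA ler_wpM2l ?(ltW (mu0 _))//.
  have [k [xk /spread_shift shift]] := net_queue_server R i sE yE qE.
  have [qiK|qiK] := ltnP.
    have m1 : (-1) ^+ 2 = 1 :> R by rewrite sqrrN expr1n.
    have := sqr_step_le V0 (centered_sqr_le x k) m1 kappa01 shift.
    by rewrite mul1r mulN1r xm /x xk opprB opprB [m + _]addrC.
  have iK : q (inr i) = K by apply/eqP; rewrite eqn_leq qK.
  have -> : Mc i = 0.
    rewrite /Mc big1// => j /qE[/eqP|//]; by rewrite iK (gtn_eqF K0).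
  by rewrite mul0r iK; case/andP: mK => ? ?; nra.
apply: le_trans (lerD (ler_sum _ (fun j _ => custE j)) (ler_sum _ (fun i _ => servE i))) _.
(* Regrouped so that each side's queues face the maxima seen by the opposite side; the mean [m]
   cancels since the total rates agree. *)
pose A := \sum_j lam j * (q (inl j))%:R - \sum_i mu i * Mc i +
  (\sum_i mu i * (q (inr i))%:R - \sum_j lam j * Ms j).
have sumE (w : 'I_n -> R) (g h : 'I_n -> R) (c : R) :
    \sum_i w i * (4 * V q * (g i - h i + c) + 10 * V q + 2) =
    4 * V q * (\sum_i w i * g i - \sum_i w i * h i) +
    (4 * V q * c + 10 * V q + 2) * \sum_i w i.
  rewrite -sumrB !mulr_sumr -big_split; apply: eq_bigr => i _ /=; ring.
rewrite !sumE.
(* The customer queues are compared at [s k], [s l] and the server queues at [l], [k], so that the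
   differences add up to [x k - x l]. *)
have Ale k l : A <= - eps * (x k - x l).
  have partc i : exists j, (i, j) \in E by exists (s i).
  have := pooling_drift (fun j => q (inl j)) (e := fun j i => (i, j) \in E)
    (s k) (s l) (ltW eps0) lammu partc poolc.
  have parts j : exists i, (i, j) \in E.
    by exists ((s^-1)%g j); have := sE ((s^-1)%g j); rewrite permKV.
  have := pooling_drift (fun i => q (inr i)) (e := fun i j => (i, j) \in E)
    l k (ltW eps0) (esym lammu) parts pools.
  rewrite -/(Mc _) -/(Ms _) /A /x /net_queue; lra.
have L0 : 0 <= L by rewrite addr_ge0// sumr_ge0// => i _; rewrite ltW.
have absorb : 4 * V q * A + 10 * L * V q <=
    - V q + n%:R * (4 * eps * ((10 * L + 1) / (4 * eps)) ^+ 3).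
  have -> : n%:R * (4 * eps * ((10 * L + 1) / (4 * eps)) ^+ 3) =
      \sum_(k < n) 4 * eps * ((10 * L + 1) / (4 * eps)) ^+ 3.
    by rewrite sumr_const card_ord -[RHS]mulr_natl.
  rewrite /V /spread -/x -sumrN mulr_sumr mulr_suml mulr_sumr -!big_split/=.
  apply: ler_sum => k _; apply: cubic_absorption => //.
  have [An Ap] := centered_drift_le Ale k.
  by case: (ger0P (centered x k)) => _ //; rewrite mulrNN.
move: absorb; rewrite /A /L lammu; nra.
Qed.

Lemma blocked_upper_bound (R : realType) n (E : {set 'I_n * 'I_n}) (s : 'S_n)
    eta K (lam mu : 'I_n -> R) (eps r L : R) (y : matching n)
    (P : probability (state n) R) :
  (0 < eta)%N -> (0 < K)%N -> (forall j, 0 < lam j) -> (forall i, 0 < mu i) ->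
  \sum_j lam j = \sum_i mu i -> (forall k, (k, s k) \in E) -> 0 < eps ->
  (forall J : {set 'I_n}, J != finset.set0 -> J \proper [set: 'I_n]%SET ->
    \sum_(j in J) lam j + eps <= \sum_(i | [exists j in J, (i, j) \in E]) mu i) ->
  (forall I : {set 'I_n}, I != finset.set0 -> I \proper [set: 'I_n]%SET ->
    \sum_(i in I) mu i + eps <= \sum_(j | [exists i in I, (i, j) \in E]) lam j) ->
  max_weight E y -> stationary (fluid_pricing eta K lam mu) y P ->
  P (reachable (fluid_pricing eta K lam mu) y) = 1%E ->
  0 < r -> r ^+ 2 * K%:R = 1 ->
  L = \sum_j lam j + \sum_i mu i ->
  K%:R * (\sum_j lam j * fine (P [set q : state n | q (inl j) = K]) +
          \sum_i mu i * fine (P [set q : state n | q (inr i) = K])) *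
    (2 * n%:R * (1 - r)) <=
  L + 2 * n%:R * L * spread_bound n L eps * r.
Proof.
move=> eta0 K0 lam0 mu0 lammu sE eps0 poolc pools yE statP Preach r0 rK LE.
set C := spread_bound n L eps.
have PK : P [set q : state n | forall a, (q a <= K)%N] = 1%E.
  apply/eqP; rewrite eq_le probability_le1//= -Preach.
  by apply: le_measure; rewrite ?inE// => q /reachable_le.
pose V q := spread (net_queue R s q).
(* The drift of V^2 has mean zero and is at most C - V. *)
have EV : expect K P V <= C.
  have := fluid_generator (fun q => V q ^+ 2) eta0 lam0 mu0 statP PK.
  set D := expect K P _ => D0.
  suff : D <= expect K P (fun q => C + -1 * V q).
    by rewrite D0 expectD expectZ expect_cst// mulN1r subr_ge0.
  apply: (le_expect Preach) => q /(reachable_no_waiting_pair yE) qE qK.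
  by rewrite /C LE; exact: spread_sqr_drift.
have id := expect_imbalance eta0 lam0 mu0 lammu
  (max_weight_matching_algorithm yE) statP PK.
move: id; rewrite -!expect_blocked// -expectD.
set S := expect K P (fun q => _ + _); set Z := expect K P _ => id.
have L0 : 0 <= L by rewrite LE addr_ge0// sumr_ge0// => i _; rewrite ltW.
have S0 : 0 <= S.
  apply: sumr_ge0 => t _.
  by rewrite mulr_ge0 ?fine_ge0 ?measure_ge0// addr_ge0// blocked_ge0.
(* Double this and use 2 Z = L - S <= L. *)
suff key : n%:R * K%:R * S + -1 * Z <=
    n%:R * r * L * expect K P V + n%:R * K%:R * r * S.
  have : n%:R * r * L * expect K P V <= n%:R * r * L * C.
    by rewrite ler_wpM2l// !mulr_ge0// ltW.
  move: id key; rewrite -LE; lra.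
rewrite -!expectZ -!expectD.
apply: (le_expect Preach) => q /(reachable_no_waiting_pair yE) qE qK.
have V0 : 0 <= V q by apply: sumr_ge0 => k _; exact: sqr_ge0.
(* AM-GM, with [K r = 1 / r] *)
have amgm (d : R) : d ^+ 2 <= V q -> d <= r * V q + K%:R * r.
  move=> dV; rewrite -subr_ge0 -(pmulr_rge0 _ r0).
  have -> : r * (r * V q + K%:R * r - d) = r ^+ 2 * V q + r ^+ 2 * K%:R - r * d.
    by ring.
  have : r ^+ 2 * d ^+ 2 <= r ^+ 2 * V q by rewrite ler_wpM2l ?sqr_ge0.
  rewrite rK; have := sqr_ge0 (r * d - 1); have := sqr_ge0 (r * d); nra.
(* Both sides at once, with [c] = 1 for customers and -1 for servers. Only full queues contribute on
   the left, and there [amgm] bounds the signed deviation. *)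
have gap (w : 'I_n -> R) (f : 'I_n -> agent n) (c : R) :
    (forall i, 0 < w i) ->
    (forall i, q (f i) = K -> exists k,
      n%:R * K%:R - c * imbalance R q = n%:R * (c * centered (net_queue R s q) k)) ->
    c ^+ 2 = 1 ->
    (n%:R * K%:R - c * imbalance R q) * blocked K w f q <=
    n%:R * r * V q * (\sum_i w i) + n%:R * K%:R * r * blocked K w f q.
  move=> w0 full c1; rewrite /blocked [leLHS]mulr_sumr.
  rewrite [X in _ <= X + _]mulr_sumr [X in _ <= _ + X]mulr_sumr -big_split/=.
  apply: ler_sum => i _; rewrite ![_ * (w i * _)]mulrCA [_ * w i]mulrC -mulrDr.
  rewrite ler_wpM2l ?(ltW (w0 i))//; case: eqP => [/full[k ->]|_]; last first.
    by rewrite !mulr0 addr0 !mulr_ge0// ltW.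
  rewrite !mulr1 -!mulrA -mulrDr ler_wpM2l//.
  by rewrite amgm// exprMn c1 mul1r centered_sqr_le.
have n0 (k : 'I_n) : n%:R != 0 :> R.
  by rewrite pnatr_eq0 -lt0n (leq_ltn_trans _ (ltn_ord k)).
have cust : (n%:R * K%:R - 1 * imbalance R q) * blocked K lam inl q <=
    n%:R * r * V q * (\sum_i lam i) + n%:R * K%:R * r * blocked K lam inl q.
  apply: gap => //; last by rewrite expr1n.
  move=> j jK; exists ((s^-1)%g j).
  rewrite /centered sum_net_queue /net_queue permKV jK.
  (* The partner of a full queue is compatible with it, hence empty, and the net queue is exactly
     K. *)
  have -> : q (inr ((s^-1)%g j)) = 0%N.
    have /qE[//|] := sE ((s^-1)%g j).
    by rewrite permKV jK => /eqP; rewrite (gtn_eqF K0).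
  by field; exact: n0 j.
have serv : (n%:R * K%:R - -1 * imbalance R q) * blocked K mu inr q <=
    n%:R * r * V q * (\sum_i mu i) + n%:R * K%:R * r * blocked K mu inr q.
  apply: gap => //; last by rewrite sqrrN expr1n.
  move=> i iK; exists i.
  rewrite /centered sum_net_queue /net_queue iK.
  have -> : q (inl (s i)) = 0%N.
    by have /qE[|//] := sE i; rewrite iK => /eqP; rewrite (gtn_eqF K0).
  by field; exact: n0 i.
move: cust serv; clear n0; rewrite LE; lra.
Qed.

(** * The lower bound and the limit by squeezing *)

Theorem proposition5 (R : realType) (n : nat) (E : {set 'I_n * 'I_n})
    (F G : 'I_n -> R -> R) (lam mu : 'I_n -> R) (chi : 'M[R]_n)
    (qmax : nat -> nat)
    (hF : forall j (x z : R), 0 <= x -> x < z -> F j z < F j x)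
    (hG : forall i (x z : R), 0 <= x -> x < z -> G i x < G i z)
    (hFc : forall j, strictly_concave_nneg (fun x => x * F j x))
    (hGc : forall i, strictly_convex_nneg (fun x => x * G i x))
    (hopt : fluid_optimal E F G lam mu chi)
    (hlam : forall j, 0 < lam j)
    (hmu : forall i, 0 < mu i)
    (hE : perfect_matching E)
    (hqmax : forall eta, (0 < eta)%N -> (0 < qmax eta)%N) :
  (forall (eta : nat) (y : matching n) (P : probability (state n) R),
     (0 < eta)%N ->
     matching_algorithm E y ->
     stationary (fluid_pricing eta (qmax eta) lam mu) y P ->
     P [set q : state n | forall a, (q a <= qmax eta)%N] = 1%E ->
     (\sum_j lam j + \sum_i mu i) / (2 * n%:R + 1 / (qmax eta)%:R) <=
     (qmax eta)%:R *
       (\sum_j lam j * fine (P [set q : state n | q (inl j) = qmax eta]) +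
        \sum_i mu i * fine (P [set q : state n | q (inr i) = qmax eta]))) /\
  (complete_resource_pooling E lam mu ->
   qmax eta @[eta --> \oo] --> \oo ->
   forall (y : nat -> matching n) (P : nat -> probability (state n) R),
     (forall eta, (0 < eta)%N ->
        [/\ max_weight E (y eta),
            stationary (fluid_pricing eta (qmax eta) lam mu) (y eta) (P eta) &
            P eta (reachable (fluid_pricing eta (qmax eta) lam mu) (y eta))
              = 1%E]) ->
     (qmax eta)%:R *
       (\sum_j lam j * fine (P eta [set q : state n | q (inl j) = qmax eta]) +
        \sum_i mu i * fine (P eta [set q : state n | q (inr i) = qmax eta]))
     @[eta --> \oo] --> (\sum_j lam j + \sum_i mu i) / (2 * n%:R)).
Proof.
(* Both totals are the total flow of [chi]. *)
have lammu : \sum_j lam j = \sum_i mu i.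
  case: hopt => -[lamE muE _ _] _.
  rewrite (eq_bigr _ (fun j _ => lamE j)) (eq_bigr _ (fun i _ => muE i)).
  exact: exchange_big.
split=> [eta y P eta0 yE statP PK|[poolc pools] qoo y P hyp].
  exact: blocked_lower_bound eta0 (hqmax eta eta0) hlam hmu lammu yE statP PK.
have [s sE] := hE.
have [n0|n0] := posnP n.
  have no (i : 'I_n) : False by case: i => m; rewrite n0.
  have sum0 (f : 'I_n -> R) : \sum_i f i = 0.
    by rewrite big1// => i; case: (no i).
  rewrite !sum0 addr0 mul0r; under eq_fun => eta do rewrite !sum0 addr0 mulr0.
  exact: cvg_cst.
have [epsc epsc0 gapc] := pooling_gap (e := fun j i => (i, j) \in E) poolc.
have [epss epss0 gaps] := pooling_gap (e := fun i j => (i, j) \in E) pools.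
pose eps := Order.min epsc epss.
have eps0 : 0 < eps by rewrite lt_min epsc0.
set L := \sum_j lam j + \sum_i mu i; pose C := spread_bound n L eps.
pose r eta : R := Num.sqrt ((qmax eta)%:R^-1).
have qpos : \forall eta \near \oo, 0 < (qmax eta)%:R :> R.
  by near=> eta; rewrite ltr0n hqmax//; near: eta; exact: nbhs_infty_gt.
have inv0 : (qmax eta)%:R^-1 @[eta --> \oo] --> (0 : R).
  by apply/gtr0_cvgV0 => //; exact/cvgrnyP.
have r0 : r eta @[eta --> \oo] --> (0 : R).
  rewrite -[X in _ --> X]sqrtr0; apply: continuous_cvg inv0.
  exact: sqrt_continuous.
have nR : 0 < n%:R :> R by rewrite ltr0n.
(* [C] does not depend on [eta] and [r] tends to 0, so both bounds tend to L / (2 n). *)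
apply: (@squeeze_cvgr _ _ _ _ (fun eta => L / (2 * n%:R + (qmax eta)%:R^-1))
  (fun eta => (L + 2 * n%:R * L * C * r eta) / (2 * n%:R * (1 - r eta)))).
- near=> eta; have eta0 : (0 < eta)%N by near: eta; exact: nbhs_infty_gt.
  have K0 := hqmax eta eta0; have [yE statP Preach] := hyp eta eta0.
  have KR : 0 < (qmax eta)%:R :> R by rewrite ltr0n.
  have PK : P eta [set q : state n | forall a, (q a <= qmax eta)%N] = 1%E.
    apply/eqP; rewrite eq_le probability_le1//= -Preach.
    by apply: le_measure; rewrite ?inE// => q /reachable_le.
  apply/andP; split.
    rewrite -[(qmax eta)%:R^-1]div1r.
    exact: (blocked_lower_bound eta0 K0 hlam hmu lammu
      (max_weight_matching_algorithm yE) statP PK).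
  have r_gt0 : 0 < r eta by rewrite sqrtr_gt0 invr_gt0.
  have rK : r eta ^+ 2 * (qmax eta)%:R = 1.
    by rewrite sqr_sqrtr ?invr_ge0// mulVf// gt_eqF.
  (* Needed to divide by 2 n (1 - r). *)
  have r1 : r eta < 1 by near: eta; exact: cvgr_lt r0 _ ltr01.
  rewrite ler_pdivlMr; last by rewrite !mulr_gt0// subr_gt0.
  apply: (blocked_upper_bound eta0 K0 hlam hmu lammu sE eps0 _ _ yE statP
    Preach r_gt0 rK erefl) => [J J0 JT|I I0 IT].
    by apply: le_trans (gapc J J0 JT); rewrite lerD2l ge_min lexx.
  by apply: le_trans (gaps I I0 IT); rewrite lerD2l ge_min lexx orbT.
- have -> : L / (2 * n%:R) = L / (2 * n%:R + 0) by rewrite addr0.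
  apply: cvgM; first exact: cvg_cst.
  apply: cvgV.
    by rewrite addr0 mulf_neq0// gt_eqF.
  by apply: cvgD => //; exact: cvg_cst.
- have -> : L / (2 * n%:R) =
      (L + 2 * n%:R * L * C * 0) / (2 * n%:R * (1 - 0)).
    by rewrite mulr0 addr0 subr0 mulr1.
  apply: cvgM.
    by apply: cvgD; [exact: cvg_cst|apply: cvgM => //; exact: cvg_cst].
  apply: cvgV; first by rewrite subr0 mulr1 mulf_neq0// gt_eqF.
  apply: cvgM; first exact: cvg_cst.
  by apply: cvgB => //; exact: cvg_cst.
Unshelve. all: by end_near. Qed.
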